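(* The pair $(\mathbb Q\rtimes\mathbb Q_+^*,\ \mathbb N\rtimes\mathbb N^\times)$ is a quasi-lattice ordered group.
   Context: $\mathbb N=\{0,1,2,\dots\}$ is the additive semigroup of natural numbers, $\mathbb N^\times$ the multiplicative semigroup of positive integers, $\mathbb Q^*_+$ the multiplicative group of positive rationals. $\mathbb Q\rtimes\mathbb Q_+^*$ is the group with operation $(r,x)(s,y)=(r+xs,xy)$ for $r,s\in\mathbb Q$, $x,y\in\mathbb Q_+^*$, and $\mathbb N\rtimes\mathbb N^\times=\{(m,a):m\in\mathbb N,a\in\mathbb N^\times\}$ is viewed as a submonoid of it; it meets its inverse only in the identity $(0,1)$. For a submonoid $P$ of a group $G$ with $P\cap P^{-1}=\{e\}$, define the left-invariant partial order on $G$ by $x\le y\iff x^{-1}y\in P$. The pair $(G,P)$ is quasi-lattice ordered if every pair of elements $x,y\in G$ which have a common upper bound in $G$ have a least upper bound $x\vee y$ in $G$. *)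

(* Defs.v *)
From HB Require Import structures.
From mathcomp Require Import all_boot all_order all_algebra.
From mathcomp Require Import archimedean.

Set Implicit Arguments.
Unset Strict Implicit.
Unset Printing Implicit Defensive.

Import Order.TTheory GRing.Theory Num.Theory.

Section QuasiLattice.
Local Open Scope group_scope.

Variables (G : groupType) (P : {pred G}).

Definition pos_le (x y : G) : bool := x^-1 * y \in P.

Definition upper_bound (x y z : G) : Prop := pos_le x z /\ pos_le y z.

Definition least_upper_bound (x y z : G) : Prop :=
  upper_bound x y z /\ (forall w : G, upper_bound x y w -> pos_le z w).

Record quasi_lattice_ordered : Prop := QuasiLatticeOrdered {
  qlo_monoid : monoid_closed P;
  qlo_pointed : forall x : G, ((x \in P) && (x^-1 \in P)) = (x == 1);
  qlo_lub : forall x y : G,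
    (exists z : G, upper_bound x y z) -> exists z : G, least_upper_bound x y z
}.

End QuasiLattice.

Local Open Scope ring_scope.

Record posrat : Type := PosRat { ratval :> rat; ratval_gt0 : 0 < ratval }.

HB.instance Definition _ := [isSub for ratval].
HB.instance Definition _ := [Choice of posrat by <:].

Section PosRatGroup.

Definition posrat_one : posrat := PosRat ltr01.

Fact posrat_mul_gt0 (x y : posrat) : 0 < (x : rat) * (y : rat).
Proof. exact: mulr_gt0 (ratval_gt0 x) (ratval_gt0 y). Qed.

Definition posrat_mul (x y : posrat) : posrat := PosRat (posrat_mul_gt0 x y).

Fact posrat_inv_gt0 (x : posrat) : 0 < (x : rat)^-1.
Proof. by rewrite invr_gt0 ratval_gt0. Qed.

Definition posrat_inv (x : posrat) : posrat := PosRat (posrat_inv_gt0 x).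

Fact posrat_mulA : associative posrat_mul.
Proof. by move=> x y z; apply: val_inj; rewrite /= mulrA. Qed.

Fact posrat_mul1 : left_id posrat_one posrat_mul.
Proof. by move=> x; apply: val_inj; rewrite /= mul1r. Qed.

Fact posrat_mulr1 : right_id posrat_one posrat_mul.
Proof. by move=> x; apply: val_inj; rewrite /= mulr1. Qed.

Fact posrat_mulV : left_inverse posrat_one posrat_inv posrat_mul.
Proof.
by move=> x; apply: val_inj; rewrite /= mulVf // gt_eqF // ratval_gt0.
Qed.

Fact posrat_mulrV : right_inverse posrat_one posrat_inv posrat_mul.
Proof.
by move=> x; apply: val_inj; rewrite /= mulfV // gt_eqF // ratval_gt0.
Qed.

End PosRatGroup.

HB.instance Definition _ := isGroup.Build posrat
  posrat_mulA posrat_mul1 posrat_mulr1 posrat_mulV posrat_mulrV.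

(* A dedicated record rather than a product type, so that the group law is the
   semidirect one and not a componentwise one. *)
Record affrat : Type := AffRat { trans : rat; scale : posrat }.

Definition pair_of_affrat (g : affrat) : rat * posrat := (trans g, scale g).
Definition affrat_of_pair (p : rat * posrat) : affrat := AffRat p.1 p.2.

Fact pair_of_affratK : cancel pair_of_affrat affrat_of_pair.
Proof. by case. Qed.

HB.instance Definition _ := Choice.copy affrat (can_type pair_of_affratK).

Section AffRatGroup.

Definition affrat_one : affrat := AffRat 0 1%g.

Definition affrat_mul (g h : affrat) : affrat :=
  AffRat (trans g + (scale g : rat) * trans h) (scale g * scale h)%g.

Definition affrat_inv (g : affrat) : affrat :=
  AffRat (- ((scale g : rat)^-1 * trans g)) (scale g)^-1%g.

Fact affrat_mulA : associative affrat_mul.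
Proof.
move=> [r x] [s y] [t z]; congr AffRat; last exact: mulgA.
by rewrite /= mulrDr addrA mulrA.
Qed.

Fact affrat_mul1 : left_id affrat_one affrat_mul.
Proof.
by move=> [r x]; congr AffRat; [rewrite /= mul1r add0r | exact: mul1g].
Qed.

Fact affrat_mulr1 : right_id affrat_one affrat_mul.
Proof.
by move=> [r x]; congr AffRat; [rewrite /= mulr0 addr0 | exact: mulg1].
Qed.

Fact affrat_mulV : left_inverse affrat_one affrat_inv affrat_mul.
Proof.
by move=> [r x]; congr AffRat; [rewrite /= addNr | exact: mulVg].
Qed.

Fact affrat_mulrV : right_inverse affrat_one affrat_inv affrat_mul.
Proof.
move=> [r x]; congr AffRat; last exact: mulgV.
by rewrite /= mulrN mulrA mulfV ?mul1r ?subrr // gt_eqF // ratval_gt0.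
Qed.

End AffRatGroup.

HB.instance Definition _ := isGroup.Build affrat
  affrat_mulA affrat_mul1 affrat_mulr1 affrat_mulV affrat_mulrV.

(* scale g > 0 always holds, so scale g being a natural number means that it is
   a positive integer. *)
Definition affnat : {pred affrat} :=
  [pred g | (trans g \is a Num.nat) && ((scale g : rat) \is a Num.nat)].

(* Main.v *)
(** In the order, [(r, x) <= (t, z)] means that [t] lies in [r + xN] and [z] in
    [xN].  For positive rationals [x] and [y], [xN] and [yN] meet in [lN] for a
    positive rational [l].  If [r + xN] and [s + yN] meet, let [t0] be the least
    common element; differences of common elements lie in [xZ] and in [yZ], so
    the intersection is [t0 + lN].  Hence [(t0, l)] is the least upper bound of
    [(r, x)] and [(s, y)]. *)
Require Import Defs.
From mathcomp Require Import all_boot all_order all_algebra.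
From mathcomp Require Import archimedean ring.

Set Implicit Arguments.
Unset Strict Implicit.
Unset Printing Implicit Defensive.

Import Order.TTheory GRing.Theory Num.Theory.
Local Open Scope ring_scope.

Lemma pos_le_affnatE (g h : affrat) :
  pos_le affnat g h =
    ((trans h - trans g) / (scale g : rat) \is a Num.nat) &&
    ((scale h : rat) / (scale g : rat) \is a Num.nat).
Proof.
rewrite /pos_le inE /= [(scale h : rat) / _]mulrC.
by congr ((_ \is a Num.nat) && _); rewrite [RHS]mulrC mulrBr addrC.
Qed.

Lemma rat_common_denominator (x y : rat) : 0 < x -> 0 < y ->
  exists a b d : nat, [/\ (0 < a)%N, (0 < b)%N, (0 < d)%N,
    x = a%:R / d%:R & y = b%:R / d%:R].
Proof.
have frac (z : rat) : 0 < z -> exists n d : nat,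
    [/\ (0 < n)%N, (0 < d)%N & z = n%:R / d%:R].
  move=> z0; exists `|numq z|%N, `|denq z|%N.
  have nz : 0 < numq z by rewrite numq_gt0.
  rewrite !absz_gt0 denq_neq0 gt_eqF //; split=> //.
  by rewrite !natr_absz !gtr0_norm ?denq_gt0 // divq_num_den.
move=> /frac[n [d [n0 d0 ->]]] /frac[m [e [m0 e0 ->]]].
have dQ : d%:R != 0 :> rat by rewrite pnatr_eq0 -lt0n.
have eQ : e%:R != 0 :> rat by rewrite pnatr_eq0 -lt0n.
exists (n * e)%N, (m * d)%N, (d * e)%N; rewrite !muln_gt0 n0 d0 m0 e0.
by split=> //; rewrite !natrM; field; rewrite dQ eQ.
Qed.

(** Over a common denominator, [x = a / d] and [y = b / d], and [l] is [lcmn a b / d]. *)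
Lemma rat_lcm (x y : rat) : 0 < x -> 0 < y -> exists l : rat,
  [/\ 0 < l, l / x \is a Num.nat, l / y \is a Num.nat &
      forall q : rat, q / x \is a Num.nat -> q / y \is a Num.nat ->
        q / l \is a Num.nat].
Proof.
move=> x0 y0.
have [a [b [d [a0 b0 d0 -> ->]]]] := rat_common_denominator x0 y0.
have l0 : (0 < lcmn a b)%N by rewrite lcmn_gt0 a0.
have aQ : a%:R != 0 :> rat by rewrite pnatr_eq0 -lt0n.
have bQ : b%:R != 0 :> rat by rewrite pnatr_eq0 -lt0n.
have dQ : d%:R != 0 :> rat by rewrite pnatr_eq0 -lt0n.
have lQ : (lcmn a b)%:R != 0 :> rat by rewrite pnatr_eq0 -lt0n.
exists ((lcmn a b)%:R / d%:R); split.
- by rewrite divr_gt0 ?ltr0n.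
- have /dvdnP[k ->] := dvdn_lcml a b; apply/natrP; exists k.
  by rewrite natrM; field; rewrite dQ aQ.
- have /dvdnP[k ->] := dvdn_lcmr a b; apply/natrP; exists k.
  by rewrite natrM; field; rewrite dQ bQ.
(* Clearing the denominator turns [q] into the natural number [m * a = n * b], a common multiple of
   [a] and [b]. *)
move=> q /natrP[m qm] /natrP[n qn].
have qdm : q * d%:R = (m * a)%:R by rewrite natrM -qm; field; rewrite dQ aQ.
have qdn : q * d%:R = (n * b)%:R by rewrite natrM -qn; field; rewrite dQ bQ.
have mn : (m * a = n * b)%N by apply/eqP; rewrite -(eqr_nat rat) -qdm qdn.
have /dvdnP[k kE] : (lcmn a b %| m * a)%N.
  by rewrite dvdn_lcm dvdn_mull //= mn dvdn_mull.
apply/natrP; exists k; apply: (mulIf lQ).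
by rewrite -natrM -kE -qdm; field; rewrite dQ lQ.
Qed.

(** Rationals are not well-ordered, but the points of [r + xN] are indexed by their natural
    coefficients. The point [t] shows that some coefficient gives a common point; since [x > 0], the
    least such coefficient gives the least common point. *)
Lemma progression_meet_min (r s t x y : rat) :
    0 < x -> (t - r) / x \is a Num.nat -> (t - s) / y \is a Num.nat ->
  exists t0 : rat,
    [/\ (t0 - r) / x \is a Num.nat, (t0 - s) / y \is a Num.nat &
        forall u : rat, (u - r) / x \is a Num.nat ->
          (u - s) / y \is a Num.nat -> t0 <= u].
Proof.
move=> x0; have coefE u n : (u - r) / x = n%:R -> u = r + n%:R * x.
  by move=> <-; rewrite divfK ?gt_eqF // addrC subrK.
move=> /natrP[m /coefE ->] ys.
have [n yn minn] := ex_minnP (ex_intro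
  (fun k : nat => (r + k%:R * x - s) / y \is a Num.nat) m ys).
exists (r + n%:R * x); split=> //.
  by rewrite [r + _]addrC addrK mulfK ?gt_eqF // natr_nat.
move=> u /natrP[k /coefE ->] /minn le_nk.
by rewrite lerD2l ler_wpM2r ?ler_nat // ltW.
Qed.

(** A difference of two naturals is an integer, and [t <= u] supplies the sign. This is where
    minimality of the common point enters. *)
Lemma natr_div_sub (r t u x : rat) :
    0 < x -> t <= u -> (t - r) / x \is a Num.nat ->
  (u - r) / x \is a Num.nat -> (u - t) / x \is a Num.nat.
Proof.
move=> x0 le_tu; rewrite !natrEint => /andP[ti _] /andP[ui _].
rewrite divr_ge0 ?subr_ge0 ?(ltW x0) // andbT.
suff -> : (u - t) / x = (u - r) / x - (t - r) / x by rewrite rpredB.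
by rewrite -mulrBl opprB addrA subrK.
Qed.

Lemma affnat_monoid_closed : monoid_closed affnat.
Proof.
split=> [|g h]; rewrite !inE /= ?rpred0 ?rpred1 //.
move=> /andP[gt gs] /andP[ht hs].
by rewrite rpredD ?rpredM.
Qed.

(** A nonzero natural number whose inverse is natural equals 1, so the scale is trivial. The
    translation part and its negative are then both nonnegative, hence zero. *)
Lemma affnat_pointed (g : affrat) :
  ((g \in affnat) && (g^-1%g \in affnat)) = (g == 1%g).
Proof.
apply/idP/eqP => [|->]; last by rewrite invg1 !(affnat_monoid_closed.1).
case: g => r x; rewrite !inE /= => /andP[/andP[rN xN] /andP[rVN xVN]].
have x0 := ratval_gt0 x.
have x1 : x = 1%g.
  apply: val_inj => /=; move: xN xVN x0 => /natrP[n ->] /natrP[m nm].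
  rewrite ltr0n => n0; have nQ : n%:R != 0 :> rat by rewrite pnatr_eq0 -lt0n.
  have /eqP : m%:R * n%:R = 1 :> rat by rewrite -nm mulVf.
  by rewrite -natrM pnatr_eq1 muln_eq1 => /andP[_ /eqP->].
rewrite x1; congr AffRat; apply/le_anti.
rewrite natr_ge0 // andbT; move: (natr_ge0 rVN).
by rewrite oppr_ge0 pmulr_rle0 ?invr_gt0.
Qed.

Theorem proposition2p2 : @quasi_lattice_ordered affrat affnat.
Proof.
split; [exact: affnat_monoid_closed | exact: affnat_pointed |].
move=> [r x] [s y] [[t z] []]; rewrite !pos_le_affnatE /=.
move=> /andP[tr _] /andP[ts _].
have x0 := ratval_gt0 x; have y0 := ratval_gt0 y.
have [t0 [t0r t0s t0min]] := progression_meet_min x0 tr ts.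
have [l [l0 lx ly lmin]] := rat_lcm x0 y0.
exists (AffRat t0 (PosRat l0)); split.
  by split; rewrite pos_le_affnatE /= ?t0r ?t0s ?lx ?ly.
move=> [u w] []; rewrite !pos_le_affnatE /= => /andP[ur wx] /andP[us wy].
have le_t0u := t0min u ur us.
(* [lmin] serves twice: for the translation difference [u - t0] and for the scale [w]. *)
by rewrite !lmin ?(natr_div_sub x0 le_t0u t0r) ?(natr_div_sub y0 le_t0u t0s).
Qed.
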